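(* Let $\mathfrak{m}\subset\mathfrak{n}$ be two nilpotent $\mathbb{F}_q$-algebras, and suppose $\mathfrak{m}$ has codimension one in $\mathfrak{n}$. Choose a nontrivial supercharacter $\gamma$ of the algebra group $U_{\mathfrak{n}/\mathfrak{m}}$ and let $\tilde\gamma$ denote its lift to $U_\mathfrak{n}$. If $\chi$ is a supercharacter of $U_\mathfrak{n}$, then the following statements hold: (1) $\chi\downarrow U_\mathfrak{m}$ is equal to $q^a$ times the sum of $q^b$ distinct supercharacters of $U_\mathfrak{m}$ of the same degree, where $a,b$ are nonnegative integers with $a+b\leq 2$. (2) If $\chi$ is irreducible, then $a=0$ and $b\in\{0,1\}$. (3) $\chi\downarrow U_\mathfrak{m}$ is a supercharacter of $U_\mathfrak{m}$ (i.e., $a=b=0$) if $\chi\otimes\tilde\gamma\neq\chi$.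
   Context: $\mathbb{F}_q$ is a finite field; all algebras are finite-dimensional associative $\mathbb{F}_q$-algebras, and $\mathfrak{m}\subset\mathfrak{n}$ means $\mathfrak{m}$ is a subalgebra. For a nilpotent $\mathbb{F}_q$-algebra $\mathfrak{n}$, the algebra group is $U_\mathfrak{n}=\{1+X:X\in\mathfrak{n}\}$ with multiplication $(1+X)(1+Y)=1+X+Y+XY$. It acts on $\mathfrak{n}$ by $(1+X)Y=Y+XY$, $Y(1+X)=Y+YX$, and on the dual space $\mathfrak{n}^*$ by $g\lambda(X)=\lambda(g^{-1}X)$, $\lambda g(X)=\lambda(Xg^{-1})$. Fix a nontrivial homomorphism $\theta:\mathbb{F}_q^+\to\mathbb{C}^\times$. The supercharacters of $U_\mathfrak{n}$ are, for $\lambda\in\mathfrak{n}^*$, $$\chi_\mathfrak{n}^\lambda(g)=\frac{|U_\mathfrak{n}\lambda|}{|U_\mathfrak{n}\lambda U_\mathfrak{n}|}\sum_{\mu\in U_\mathfrak{n}\lambda U_\mathfrak{n}}\theta\circ\mu(g-1).$$ $\downarrow$ denotes restriction of functions, and $\otimes$ denotes the pointwise product of characters. A subalgebra $\mathfrak{m}$ of codimension one in a nilpotent algebra $\mathfrak{n}$ is automatically a two-sided ideal, so $\mathfrak{n}/\mathfrak{m}$ is a nilpotent $\mathbb{F}_q$-algebra. The lift to $U_\mathfrak{n}$ of a supercharacter $\gamma$ of $U_{\mathfrak{n}/\mathfrak{m}}$ is $\tilde\gamma(1+X)=\gamma(1+(X+\mathfrak{m}))$ for $X\in\mathfrak{n}$.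 *)

(* Defs.v *)
From HB Require Import structures.
From mathcomp Require Import all_boot all_order all_algebra all_fingroup.
From mathcomp Require Import all_solvable all_field all_character.

Set Implicit Arguments.
Unset Strict Implicit.
Unset Printing Implicit Defensive.

Import GRing.Theory.
Local Open Scope ring_scope.

(* MathComp's algebras are unital, so nilpotent algebras get their own
   structure: a finite-dimensional space with an associative bilinear product
   (no unit) such that all products of sufficiently many factors vanish.  By
   associativity it is enough to consider left-bracketed products. *)
HB.mixin Record isNilAlg (F : fieldType) V of Vector F V := {
  nmul : V -> V -> V;
  nmulA : associative nmul;
  nmulDl : left_distributive nmul +%R;
  nmulDr : right_distributive nmul +%R;
  nmulZl : forall (c : F) x y, nmul (c *: x) y = c *: nmul x y;
  nmulZr : forall (c : F) x y, nmul x (c *: y) = c *: nmul x y;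
  nmul_nilpotent :
    exists k, forall x (s : seq V), size s = k -> foldl nmul x s = 0
}.

#[short(type="nilAlgType")]
HB.structure Definition NilAlg (F : fieldType) :=
  {V of isNilAlg F V & Vector F V}.

Notation "x ** y" := (nmul x y) (at level 40, left associativity) : ring_scope.

Section NilAlgTheory.
Variables (F : fieldType) (V : nilAlgType F).
Implicit Types x y z : V.

Fact nmulr_is_linear x : linear (nmul x).
Proof. by move=> c y z; rewrite nmulDr nmulZr. Qed.
HB.instance Definition _ x :=
  GRing.isLinear.Build F V V *:%R (nmul x) (nmulr_is_linear x).

Fact nmull_is_linear y : linear (nmul^~ y).
Proof. by move=> c x z; rewrite nmulDl nmulZl. Qed.

Lemma nmul0r x : 0 ** x = 0 :> V.
Proof. by rewrite -[0 in LHS](scale0r (0 : V)) nmulZl scale0r. Qed.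

Lemma nmulr0 x : x ** 0 = 0 :> V.
Proof. exact: linear0. Qed.

Lemma nmulrN x y : x ** (- y) = - (x ** y).
Proof. exact: linearN. Qed.

Lemma nmulNr x y : (- x) ** y = - (x ** y).
Proof. by rewrite -scaleN1r nmulZl scaleN1r. Qed.

Lemma nmulBr x y z : x ** (y - z) = x ** y - x ** z.
Proof. exact: linearB. Qed.

Lemma nmulBl x y z : (x - y) ** z = x ** z - y ** z.
Proof. by rewrite nmulDl nmulNr. Qed.

Lemma iter_nmulr_nilp : exists k, forall x y, iter k (nmul^~ y) x = 0.
Proof.
have [k nilk] := @nmul_nilpotent F V; exists k => x y.
have -> : iter k (nmul^~ y) x = foldl nmul x (nseq k y).
  by elim: k {nilk} x => //= k IHk x; rewrite -IHk -iterSr.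
by rewrite nilk ?size_nseq.
Qed.

Lemma iter_nmull_nilp : exists k, forall x y, iter k (nmul x) y = 0.
Proof.
have [k nilk] := iter_nmulr_nilp; exists k.+1 => x y.
have -> : iter k.+1 (nmul x) y = iter k (nmul^~ x) x ** y.
  elim: k {nilk} => //= k IHk; rewrite IHk nmulA; congr (_ ** _).
  by elim: k {IHk} => //= k IHk; rewrite nmulA IHk.
by rewrite nilk nmul0r.
Qed.

End NilAlgTheory.

Section Subalgebras.
Variables (F : fieldType) (V : nilAlgType F).

Record subalgebra := Subalgebra {
  subalgebra_vspace :> {vspace V};
  subalgebra_mul : forall x y,
    x \in subalgebra_vspace -> y \in subalgebra_vspace ->
    x ** y \in subalgebra_vspace
}.

Record ideal := Ideal {
  ideal_vspace :> {vspace V};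
  ideal_mull : forall x y, y \in ideal_vspace -> x ** y \in ideal_vspace;
  ideal_mulr : forall x y, x \in ideal_vspace -> x ** y \in ideal_vspace
}.

Definition codim_one (U : {vspace V}) := \dim {:V} = (\dim U).+1.

End Subalgebras.

Section SubalgebraNilAlg.
Variables (F : fieldType) (V : nilAlgType F) (m : subalgebra V).

Definition subalg_nmul (x y : subvs_of m) : subvs_of m :=
  Subvs (subalgebra_mul (subvsP x) (subvsP y)).

Fact subalg_nmulA : associative subalg_nmul.
Proof. by move=> x y z; apply: val_inj; apply: nmulA. Qed.
Fact subalg_nmulDl : left_distributive subalg_nmul +%R.
Proof. by move=> x y z; apply: val_inj; apply: nmulDl. Qed.
Fact subalg_nmulDr : right_distributive subalg_nmul +%R.
Proof. by move=> x y z; apply: val_inj; apply: nmulDr. Qed.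
Fact subalg_nmulZl (c : F) x y :
  subalg_nmul (c *: x) y = c *: subalg_nmul x y.
Proof. by apply: val_inj; apply: nmulZl. Qed.
Fact subalg_nmulZr (c : F) x y :
  subalg_nmul x (c *: y) = c *: subalg_nmul x y.
Proof. by apply: val_inj; apply: nmulZr. Qed.
Fact subalg_nilpotent : exists k, forall x (s : seq (subvs_of m)),
  size s = k -> foldl subalg_nmul x s = 0.
Proof.
have [k nilk] := @nmul_nilpotent F V; exists k => x s sz_s.
apply: val_inj; transitivity (foldl nmul (vsval x) (map vsval s)).
  by elim: s {sz_s} x => //= y s ->.
by rewrite nilk ?size_map.
Qed.

HB.instance Definition _ := isNilAlg.Build F (subvs_of m) subalg_nmulA
  subalg_nmulDl subalg_nmulDr subalg_nmulZl subalg_nmulZr subalg_nilpotent.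

End SubalgebraNilAlg.

Section CosetSpace.
Variables (F : fieldType) (V : vectType F) (U : {vspace V}).
Local Open Scope quotient_scope.

(* The library only makes this quotient a zmodType. *)
Definition coset_space := Quotient.quot (pred_of_vspace U : zmodClosed V).

HB.instance Definition _ := GRing.Zmodule.on coset_space.

Definition coset_of_vec (x : V) : coset_space := \pi_coset_space x.

Definition vec_of_coset (u : coset_space) : V := generic_quotient.repr u.

Lemma coset_of_vecP x y : reflect (coset_of_vec x = coset_of_vec y) (x - y \in U).
Proof.
by have := Quotient.idealrBE (pred_of_vspace U : zmodClosed V) x y => ->; apply: eqP.
Qed.

Lemma coset_of_vecD : {morph coset_of_vec : x y / x + y}.
Proof. by move=> x y; rewrite /coset_of_vec Quotient.pi_add. Qed.

Lemma coset_of_vec_surj (u : coset_space) : coset_of_vec (vec_of_coset u) = u.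
Proof. exact: reprK. Qed.

Definition coset_scale (c : F) (u : coset_space) := coset_of_vec (c *: vec_of_coset u).

Lemma coset_of_vecZ c x : coset_of_vec (c *: x) = coset_scale c (coset_of_vec x).
Proof.
apply/coset_of_vecP; rewrite -scalerBr memvZ //.
by apply/coset_of_vecP; rewrite coset_of_vec_surj.
Qed.

Fact coset_scaleA a b u :
  coset_scale a (coset_scale b u) = coset_scale (a * b) u.
Proof. by rewrite -[u]coset_of_vec_surj -!coset_of_vecZ scalerA. Qed.
Fact coset_scale1 : left_id 1 coset_scale.
Proof. by move=> u; rewrite -[u]coset_of_vec_surj -coset_of_vecZ scale1r. Qed.
Fact coset_scaleDr : right_distributive coset_scale +%R.
Proof.
move=> a u w; rewrite -[u]coset_of_vec_surj -[w]coset_of_vec_surj.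
by rewrite -coset_of_vecD -!coset_of_vecZ scalerDr coset_of_vecD.
Qed.
Fact coset_scaleDl u : {morph coset_scale^~ u : a b / a + b}.
Proof.
move=> a b; rewrite -[u]coset_of_vec_surj.
by rewrite -!coset_of_vecZ scalerDl coset_of_vecD.
Qed.

HB.instance Definition _ := GRing.Zmodule_isLmodule.Build F coset_space
  coset_scaleA coset_scale1 coset_scaleDr coset_scaleDl.

Fact coset_of_vec_is_linear : linear coset_of_vec.
Proof. by move=> c x y; rewrite coset_of_vecD coset_of_vecZ. Qed.
HB.instance Definition _ := GRing.isLinear.Build F V coset_space *:%R
  coset_of_vec coset_of_vec_is_linear.

Lemma coset_of_vec_eq0P x : reflect (coset_of_vec x = 0) (x \in U).
Proof.
by rewrite -[0](linear0 coset_of_vec) -[x in x \in _]subr0; apply: coset_of_vecP.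
Qed.

(* Coordinates on V/U: those of the projection onto a complement of U. *)
Fact coset_space_vect_iso : Vector.axiom (\dim U^C) coset_space.
Proof.
pose W := subvs_of U^C.
pose f (u : coset_space) : W := vsproj U^C (vec_of_coset u - projv U (vec_of_coset u)).
pose g (w : W) := coset_of_vec (vsval w).
have fE x : vsval (f (coset_of_vec x)) = x - projv U x.
  rewrite vsprojK ?memv_projC //; set r := vec_of_coset _.
  have rx : r - x \in U by apply/coset_of_vecP; apply: coset_of_vec_surj.
  apply/eqP; rewrite -subr_eq0 opprB [projv U x - x]addrC addrACA.
  rewrite [- _ + projv U x]addrC -[projv U x - _]opprB -linearB /=.
  by rewrite projv_id // subrr.
have fK : cancel f g.
  move=> u; rewrite -[u in LHS]coset_of_vec_surj /g fE -[RHS]coset_of_vec_surj.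
  apply/coset_of_vecP.
  by rewrite addrAC subrr add0r memvN memv_proj.
have g_lin : linear g by move=> c x y; rewrite /g linearP.
have gK : cancel g f.
  move=> w; apply: val_inj; rewrite /g /= fE.
  suff -> : projv U (vsval w) = 0 by rewrite subr0.
  by apply/eqP; rewrite -memv_ker lker_proj subvsP.
have f_lin : linear f.
  by move=> c x y; rewrite -[x in LHS]fK -[y in LHS]fK -g_lin gK.
have [h h_lin h_bij] := subvs_vect_iso U^C%VS.
exists (h \o f) => [c x y|]; first by rewrite /= f_lin h_lin.
by apply: bij_comp => //; exists g.
Qed.

HB.instance Definition _ :=
  Lmodule_hasFinDim.Build F coset_space coset_space_vect_iso.

End CosetSpace.

Arguments coset_of_vec {F V} U x.
Arguments vec_of_coset {F V U} u.

Section QuotientAlgebra.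
Variables (F : fieldType) (V : nilAlgType F) (I : ideal V).
Implicit Types u w : coset_space I.

Definition quotient_nmul u w : coset_space I :=
  coset_of_vec I (vec_of_coset u ** vec_of_coset w).

Lemma coset_of_vecM x y :
  coset_of_vec I (x ** y) = quotient_nmul (coset_of_vec I x) (coset_of_vec I y).
Proof.
apply/coset_of_vecP; set x' := vec_of_coset _; set y' := vec_of_coset _.
have x'P : x - x' \in I.
  by apply/coset_of_vecP; rewrite coset_of_vec_surj.
have y'P : y - y' \in I.
  by apply/coset_of_vecP; rewrite coset_of_vec_surj.
have -> : x ** y - x' ** y' = (x - x') ** y + x' ** (y - y').
  by rewrite nmulBl nmulBr addrA subrK.
by apply: memvD; [apply: ideal_mulr | apply: ideal_mull].
Qed.

Fact quotient_nmulA : associative quotient_nmul.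
Proof.
move=> u w z; rewrite -[u]coset_of_vec_surj -[w]coset_of_vec_surj.
by rewrite -[z]coset_of_vec_surj -!coset_of_vecM nmulA.
Qed.
Fact quotient_nmulDl : left_distributive quotient_nmul +%R.
Proof.
move=> u w z; rewrite -[u]coset_of_vec_surj -[w]coset_of_vec_surj.
rewrite -[z]coset_of_vec_surj -coset_of_vecD -!coset_of_vecM.
by rewrite -coset_of_vecD nmulDl.
Qed.
Fact quotient_nmulDr : right_distributive quotient_nmul +%R.
Proof.
move=> u w z; rewrite -[u]coset_of_vec_surj -[w]coset_of_vec_surj.
rewrite -[z]coset_of_vec_surj -coset_of_vecD -!coset_of_vecM.
by rewrite -coset_of_vecD nmulDr.
Qed.
Fact quotient_nmulZl (c : F) u w :
  quotient_nmul (c *: u) w = c *: quotient_nmul u w.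
Proof.
rewrite -[u]coset_of_vec_surj -[w]coset_of_vec_surj.
by rewrite -linearZ -!coset_of_vecM -linearZ nmulZl.
Qed.
Fact quotient_nmulZr (c : F) u w :
  quotient_nmul u (c *: w) = c *: quotient_nmul u w.
Proof.
rewrite -[u]coset_of_vec_surj -[w]coset_of_vec_surj.
by rewrite -linearZ -!coset_of_vecM -linearZ nmulZr.
Qed.
Fact quotient_nilpotent : exists k, forall u (s : seq (coset_space I)),
  size s = k -> foldl quotient_nmul u s = 0.
Proof.
have [k nilk] := @nmul_nilpotent F V; exists k => u s sz_s.
transitivity (coset_of_vec I (foldl nmul (vec_of_coset u) (map vec_of_coset s))).
  rewrite -[u in LHS]coset_of_vec_surj; elim: s {sz_s} (vec_of_coset u) => //= w s IHs x.
  by rewrite -[w in LHS]coset_of_vec_surj -coset_of_vecM IHs.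
by rewrite nilk ?size_map // linear0.
Qed.

HB.instance Definition _ := isNilAlg.Build F (coset_space I) quotient_nmulA
  quotient_nmulDl quotient_nmulDr quotient_nmulZl quotient_nmulZr
  quotient_nilpotent.

End QuotientAlgebra.

Section CodimOneIdeal.
Variables (F : fieldType) (V : nilAlgType F) (m : subalgebra V).
Hypothesis codim1 : codim_one m.

Fact codim_one_split v w : v \notin m -> exists c : F, w - c *: v \in m.
Proof.
move=> vNm; have full : (m + <[v]>)%VS = fullv.
  apply/eqP; rewrite eqEdim subvf /= codim1 dimv_disjoint_sum.
    by rewrite dim_vline; case: eqP vNm => [->|]; rewrite ?mem0v // addn1.
  apply/eqP; rewrite -subv0; apply/subvP=> x; rewrite memv_cap.
  case/andP=> xm /vlineP[c xE]; rewrite memv0.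
  have [c0 | c_nz] := eqVneq c 0; first by rewrite xE c0 scale0r.
  case/negP: vNm; rewrite -[v](scalerK c_nz) -xE.
  by rewrite memvZ.
have /memv_addP[x xm [_ /vlineP[c ->] wE]] : w \in (m + <[v]>)%VS.
  by rewrite full memvf.
by exists c; rewrite wE addrK.
Qed.

(* A linear nilpotent f that stabilises m acts nilpotently on the line V/m,
   that is, by zero. *)
Fact codim_one_nilp (f : {linear V -> V}) : (forall x, x \in m -> f x \in m) ->
  (exists k, forall x, iter k f x = 0) -> forall x, f x \in m.
Proof.
move=> fm [k fk] v; have [/fm // | vNm] := boolP (v \in m).
have [c fv] := codim_one_split (f v) vNm.
have [c0 | c_nz] := eqVneq c 0; first by rewrite c0 scale0r subr0 in fv.
have iterP j : iter j f v - c ^+ j *: v \in m.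
  elim: j => [|j IHj]; first by rewrite expr0 scale1r subrr mem0v.
  have -> : iter j.+1 f v - c ^+ j.+1 *: v =
      f (iter j f v - c ^+ j *: v) + c ^+ j *: (f v - c *: v).
    rewrite [f (_ - _)]linearB [f (c ^+ j *: v)]linearZ /=.
    by rewrite [_ *: (_ - _)]scalerBr scalerA -exprSr addrA subrK.
  by apply: memvD; [apply: fm | apply: memvZ].
case/negP: vNm; have := iterP k; rewrite fk sub0r memvN => /(memvZ (c ^- k)).
by rewrite scalerK // expf_neq0.
Qed.

Fact codim_one_mulr x y : x \in m -> x ** y \in m.
Proof.
move=> xm; apply: (codim_one_nilp (f := nmul x)) => [z|].
  exact: subalgebra_mul.
by have [k nilk] := iter_nmull_nilp V; exists k => z; apply: nilk.
Qed.

Fact codim_one_mull x y : y \in m -> x ** y \in m.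
Proof.
move=> ym; pose f := HB.pack_for {linear V -> V} (nmul^~ y)
  (GRing.isLinear.Build F V V *:%R (nmul^~ y) (nmull_is_linear y)).
apply: (codim_one_nilp (f := f)) => [z zm|]; first exact: subalgebra_mul.
by have [k nilk] := iter_nmulr_nilp V; exists k => z; apply: nilk.
Qed.

Definition codim_one_ideal : ideal V := Ideal codim_one_mull codim_one_mulr.

End CodimOneIdeal.

Section AlgebraGroup.
Variables (F : finFieldType) (V : nilAlgType F).

(* The element 1 + X of U_V is represented by OnePlus X. *)
Inductive algebra_group : predArgType := OnePlus of V.

Definition minus_one (g : algebra_group) : V := let: OnePlus x := g in x.

Lemma OnePlusK : cancel OnePlus minus_one. Proof. by []. Qed.
Lemma minus_oneK : cancel minus_one OnePlus. Proof. by case. Qed.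

HB.instance Definition _ := [isNew for minus_one].
Fact minus_one_finvectK :
  cancel (minus_one : algebra_group -> finvect_type V) OnePlus.
Proof. exact: minus_oneK. Qed.
HB.instance Definition _ :=
  Finite.copy algebra_group (can_type minus_one_finvectK).

Implicit Types g h : algebra_group.

Definition ag_one := OnePlus 0.
Definition ag_mul g h :=
  let: OnePlus x := g in let: OnePlus y := h in OnePlus (x + y + x ** y).

Fact ag_mulA : associative ag_mul.
Proof.
case=> [x] [y] [z] /=; congr OnePlus.
rewrite !nmulDr !nmulDl nmulA !addrA.
by rewrite [LHS](ACl (1 * 2 * 5 * 3 * 6 * 4 * 7)).
Qed.

Fact ag_mul1 : left_id ag_one ag_mul.
Proof. by case=> x /=; rewrite add0r nmul0r addr0. Qed.

Fact ag_mul_inj h : injective (ag_mul^~ h).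
Proof.
case: h => [y] [x1] [x2] /= [/eqP eq_x]; congr OnePlus.
apply/eqP; rewrite -subr_eq0; set d := x1 - x2.
have dE : d = d ** (- y).
  apply/eqP; rewrite nmulrN -addr_eq0 /d nmulBl.
  move: eq_x; rewrite -subr_eq0 opprD addrACA.
  by have -> : x1 + y - (x2 + y) = x1 - x2 by rewrite opprD addrACA subrr addr0.
have [k nilk] := iter_nmulr_nilp V.
suff -> : d = iter k (nmul^~ (- y)) d by rewrite nilk.
by elim: k {nilk} => //= k <-.
Qed.

Definition ag_inv g := invF (@ag_mul_inj g) ag_one.

Fact ag_mulV : left_inverse ag_one ag_inv ag_mul.
Proof. by move=> g; apply: (f_invF (@ag_mul_inj g)). Qed.

HB.instance Definition _ :=
  Finite_isGroup.Build algebra_group ag_mulA ag_mul1 ag_mulV.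

Lemma ag_mulE x y : (OnePlus x * OnePlus y)%g = OnePlus (x + y + x ** y).
Proof. by []. Qed.

Definition ag_lact g x : V := x + minus_one g ** x.
Definition ag_ract x g : V := x + x ** minus_one g.

Definition dual := finvect_type 'Hom(V, F^o).

Definition dual_lact g (l : dual) : dual :=
  linfun (fun x => (l : 'Hom(V, F^o)) (ag_lact g^-1%g x)).
Definition dual_ract (l : dual) g : dual :=
  linfun (fun x => (l : 'Hom(V, F^o)) (ag_ract x g^-1%g)).

Lemma dual_lactE g l x :
  (dual_lact g l : 'Hom(V, F^o)) x = (l : 'Hom(V, F^o)) (ag_lact g^-1%g x).
Proof.
pose f x := (l : 'Hom(V, F^o)) (ag_lact g^-1%g x).
have f_lin : linear f.
  move=> c y z; rewrite /f -[RHS]linearP; congr (fun_of_lfun _ _).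
  by rewrite /ag_lact linearP scalerDr addrACA.
pose f' := HB.pack_for {linear V -> F^o} f
  (GRing.isLinear.Build F V F^o *:%R f f_lin).
exact: (lfunE f').
Qed.

Lemma dual_ractE g l x :
  (dual_ract l g : 'Hom(V, F^o)) x = (l : 'Hom(V, F^o)) (ag_ract x g^-1%g).
Proof.
pose f x := (l : 'Hom(V, F^o)) (ag_ract x g^-1%g).
have f_lin : linear f.
  move=> c y z; rewrite /f -[RHS]linearP; congr (fun_of_lfun _ _).
  by rewrite /ag_ract [LHS](congr1 _ (nmull_is_linear _ _ _ _)) scalerDr addrACA.
pose f' := HB.pack_for {linear V -> F^o} f
  (GRing.isLinear.Build F V F^o *:%R f f_lin).
exact: (lfunE f').
Qed.

Definition left_orbit (l : dual) : {set dual} :=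
  [set dual_lact g l | g : algebra_group].
Definition two_sided_orbit (l : dual) : {set dual} :=
  [set dual_ract (dual_lact g l) h | g : algebra_group, h : algebra_group].

(* Functions on U_V take values in algC; this loses nothing, since the values of
   an additive character of F are roots of unity. *)
Definition supercharacter (theta : F -> algC) (l : dual) :
    {ffun algebra_group -> algC} :=
  [ffun g => #|left_orbit l|%:R / #|two_sided_orbit l|%:R *
    \sum_(mu in two_sided_orbit l) theta ((mu : 'Hom(V, F^o)) (minus_one g))].

Definition is_supercharacter theta (chi : {ffun algebra_group -> algC}) :=
  exists l : dual, chi = supercharacter theta l.

Definition irreducible_character (chi : {ffun algebra_group -> algC}) :=
  exists2 phi : 'CF([set: algebra_group]),
    phi \in irr [set: algebra_group] & forall g, chi g = phi g.

End AlgebraGroup.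

Arguments OnePlus {F V} _.
Arguments algebra_group {F} V.

Definition nontrivial_additive_character (F : finFieldType)
    (theta : F -> algC) :=
  [/\ forall x, theta x != 0, {morph theta : x y / x + y >-> x * y}
    & exists x, theta x != 1].

Section RestrictionAndLift.
Variables (F : finFieldType) (V : nilAlgType F).

Definition restriction (m : subalgebra V) (chi : {ffun algebra_group V -> algC}) :
    {ffun algebra_group (subvs_of m) -> algC} :=
  [ffun g => chi (OnePlus (vsval (minus_one g)))].

Definition lifted_function (I : ideal V) (gamma : {ffun algebra_group (coset_space I) -> algC}) :
    {ffun algebra_group V -> algC} :=
  [ffun g => gamma (OnePlus (coset_of_vec I (minus_one g)))].

Definition pointwise_product (chi psi : {ffun algebra_group V -> algC}) :
    {ffun algebra_group V -> algC} :=
  [ffun g => chi g * psi g].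

(* psi is q^a times the sum of q^b distinct supercharacters of equal degree. *)
Definition supercharacter_multiple (theta : F -> algC) (a b : nat)
    (psi : {ffun algebra_group V -> algC}) :=
  exists S : seq {ffun algebra_group V -> algC},
    [/\ uniq S, size S = (#|F| ^ b)%N,
        forall phi, phi \in S -> is_supercharacter theta phi,
        forall phi phi', phi \in S -> phi' \in S -> phi 1%g = phi' 1%g
      & forall g, psi g = (#|F| ^ a)%:R * \sum_(phi <- S) phi g].

End RestrictionAndLift.

(* Main.v *)
Require Import Defs.
From HB Require Import structures.
From mathcomp Require Import all_boot all_order all_algebra all_fingroup.
From mathcomp Require Import all_solvable all_field all_character.
From mathcomp Require Import zify ring.
Import GRing.Theory Num.Theory.
Local Open Scope ring_scope.

(** Write l for a functional on n, l' for its restriction to m, and U, U_m for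
    the two algebra groups. The product of n takes values in m, so U x U acts on
    the duals of both n and m, and the supercharacter of l is |U l| times the
    average of theta \o mu over the orbit of l. Restricting to m turns this into
    |U l| times the average over the orbit P of l' under U x U. Now U_m x U_m is
    normal in U x U, hence P splits into two-sided U_m-orbits of one common
    size, all with left orbits of one common size
    ([restriction_supercharacter_multiple]). It remains to see that the number
    of these orbits is q^b and that |U l| / |U_m l'| is q^(a + b).

    Both follow from linearity. An element (1 + x, 1 + y) fixes a functional mu
    iff mu (x w) = mu (w y) for all w, so the stabiliser is a kernel and
    |U mu U| = q^d, where d is the dimension of the space spanned by the
    functionals mu (x _) and mu (_ y) ([card_dual_orbit]). In the same way |U l|
    is q to the rank of the form (x, y) |-> l (x y). Hence a + b is the drop of
    the rank of this form from n x n to m x m, at most 2, and b is the drop of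
    dimension of the span of the functionals l (x _) and l (_ y) on m when x and
    y are confined to m ([restriction_exponents]). The inequality b <= a + b
    comes from [hyperplane_functional_in_limg]: if adding a column to the form
    on m x m raises the rank, then a nonzero functional nu killing m has the
    form l (x _), and so the rank drops again from n x n to n x m.

    For the second claim, orthogonality of the functions theta \o mu gives
    |U l|^2 = |U l U| when the supercharacter of l is irreducible
    ([irreducible_card_orbit]). Since |U l U| <= q |P|, and
    |U_m l' U_m| <= |U_m l'|^2 because row rank equals column rank, this
    forces 2 a + b <= 1.

    For the third claim, gamma lifts to theta \o nu with nu as above. If
    a + b > 0, then nu is l (x _) or l (_ y) for some x or y, so that l + nu lies
    in the orbit U l U; this orbit is then stable under adding nu and
    multiplication by theta \o nu fixes the supercharacter. *)

Set Implicit Arguments.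
Unset Strict Implicit.
Unset Printing Implicit Defensive.

(** * Functionals and dimensions *)

Section Functionals.
Variable K : fieldType.
Implicit Types A B : vectType K.

(** Each further functional cuts the common kernel by at most one dimension. *)
Lemma dim_common_kernel A (s : seq 'Hom(A, K^o)) :
  (\dim {:A} <= \dim (\bigcap_(u <- s) lker u)%VS + size s)%N.
Proof.
elim: s => [|u s IHs] /=; first by rewrite big_nil addn0.
rewrite big_cons capvC; set C := (\bigcap_(_ <- s) _)%VS in IHs *.
rewrite (leq_trans IHs) // -(limg_ker_dim u C) addnS -addSn leq_add2r.
by rewrite -addn1 leq_add2l (leq_trans (dimvS (subvf _))) // dimvf.
Qed.

(** Eliminating the functionals of s one at a time: if x0 is killed by the
    tail but not by the head u, then f - (f x0 / u x0) u vanishes wherever the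
    tail does. *)
Lemma common_kernel_span A (s : seq 'Hom(A, K^o)) (f : 'Hom(A, K^o)) :
  (\bigcap_(u <- s) lker u <= lker f)%VS -> f \in <<s>>%VS.
Proof.
elim: s f => [|u s IHs] f.
  rewrite big_nil span_nil memv0 => /subvP fP; apply/eqP/lfunP=> x.
  by rewrite zero_lfunE; apply/eqP; rewrite -memv_ker fP ?memvf.
rewrite big_cons span_cons; set C := (\bigcap_(_ <- s) _)%VS in IHs * => kerf.
have [Cu | /subvPn[x0 Cx0]] := boolP (C <= lker u)%VS.
  rewrite (subvP (addvSr _ _)) // IHs //.
  by apply: subv_trans kerf; rewrite subv_cap Cu subvv.
rewrite memv_ker => ux0; pose c : K := f x0 / u x0.
rewrite -[f](subrK (c *: u)) addrC memv_add ?memvZ ?memv_line // IHs //.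
apply/subvP=> x Cx; rewrite memv_ker add_lfunE opp_lfunE scale_lfunE.
have : x - (u x / u x0 : K) *: x0 \in lker f.
  apply: (subvP kerf); rewrite memv_cap; apply/andP; split; last first.
    by rewrite memvB ?memvZ.
  by rewrite memv_ker linearB linearZ /= /GRing.scale /= divfK ?subrr.
rewrite memv_ker linearB linearZ /= /GRing.scale /=.
by have -> : u x / u x0 * f x0 = c * u x by rewrite /c mulrC mulrAC mulrA mulrAC.
Qed.

Lemma mem_common_kernel A (s : seq 'Hom(A, K^o)) x :
  (x \in \bigcap_(u <- s) lker u)%VS = all (fun u : 'Hom(A, K^o) => u x == 0) s.
Proof.
by elim: s => [|u s IHs]; rewrite ?big_nil ?memvf // big_cons memv_cap memv_ker IHs.
Qed.

Lemma mem_kernel_vbasis A (U : {vspace 'Hom(A, K^o)}) x :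
  reflect (forall u, u \in U -> u x = 0)
          (x \in \bigcap_(u <- vbasis U) lker u)%VS.
Proof.
rewrite mem_common_kernel; apply: (iffP allP) => [killU u | killU u Uu].
  move/coord_vbasis->; rewrite sum_lfunE big1 // => i _; rewrite scale_lfunE.
  by rewrite (eqP (killU _ _)) ?mem_nth ?size_tuple // scaler0.
by rewrite killU // vbasis_mem.
Qed.

(** A subspace of a finite-dimensional dual is the annihilator of its
    annihilator. *)
Lemma functional_separation A (U : {vspace 'Hom(A, K^o)}) (f : 'Hom(A, K^o)) :
  f \notin U -> exists2 x, forall u, u \in U -> u x = 0 & f x != 0.
Proof.
move=> fNU; have /subvPn[x /mem_kernel_vbasis killU]:
    ~~ (\bigcap_(u <- vbasis U) lker u <= lker f)%VS.
  by apply: contra fNU => /common_kernel_span; rewrite (span_basis (vbasisP U)).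
by rewrite memv_ker; exists x.
Qed.

(** Row rank equals column rank: l and r are the two maps given by one bilinear
    form on A and B, and the kernel of l is the annihilator of the image
    of r. *)
Lemma rank_transpose_leq A B (l : 'Hom(A, 'Hom(B, K^o)))
    (r : 'Hom(B, 'Hom(A, K^o))) :
  (forall x y, l x y = r y x) -> (\dim (limg l) <= \dim (limg r))%N.
Proof.
move=> lr; set C := (\bigcap_(u <- vbasis (limg r)) lker u)%VS.
have subC : (C <= lker l)%VS.
  apply/subvP=> x /mem_kernel_vbasis killr; rewrite memv_ker; apply/eqP/lfunP=> y.
  by rewrite zero_lfunE lr killr // memv_img ?memvf.
have := dim_common_kernel (vbasis (limg r)); rewrite size_tuple -/C => le1.
have le2 : (\dim {:A} <= \dim (lker l) + \dim (limg r))%N.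
  by rewrite (leq_trans le1) // leq_add2r dimvS.
by move: le2; rewrite -(limg_ker_dim l fullv) capfv leq_add2l.
Qed.

Lemma rank_transpose A B (l : 'Hom(A, 'Hom(B, K^o)))
    (r : 'Hom(B, 'Hom(A, K^o))) :
  (forall x y, l x y = r y x) -> \dim (limg l) = \dim (limg r).
Proof.
by move=> lr; apply/eqP; rewrite eqn_leq !rank_transpose_leq // => x y; rewrite lr.
Qed.

Lemma dim_sum_increment A (U U' W W' : {vspace A}) :
  (U <= U')%VS -> (W <= W')%VS ->
  (\dim (U' + W')%VS + \dim U + \dim W
     <= \dim (U + W)%VS + \dim U' + \dim W')%N.
Proof.
move=> sU sW; have := dimv_sum_cap U W; have := dimv_sum_cap U' W'.
have : (\dim (U :&: W) <= \dim (U' :&: W'))%N by rewrite dimvS ?capvS.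
lia.
Qed.

Lemma dim_limg_hyperplane A B (f : 'Hom(A, B)) (U : {vspace A}) :
  \dim {:A} = (\dim U).+1 -> (\dim (limg f) <= (\dim (f @: U)).+1)%N.
Proof.
move=> hypU; have := limg_ker_dim f U; have := limg_ker_dim f fullv.
have : (\dim (U :&: lker f) <= \dim (fullv :&: lker f))%N.
  by rewrite dimvS // capvS ?subvf.
lia.
Qed.

End Functionals.

(** * Bimodules over a nilpotent algebra *)

Lemma linear_lfun (F : fieldType) (A B : vectType F) (f : A -> B) :
  linear f -> {g : 'Hom(A, B) | g =1 f}.
Proof.
move=> f_lin.
pose f' := HB.pack_for {linear A -> B} f (GRing.isLinear.Build F A B *:%R f f_lin).
by exists (linfun f') => x; rewrite lfunE.
Qed.

Section Bimodule.
Variables (F : fieldType) (V : nilAlgType F).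

(** The duals of the algebra and of its hyperplane subalgebra are acted upon by
    the same group: both spaces are bimodules over the large algebra. *)
Record bimodule (W : vectType F) := Bimodule {
  lmul : V -> W -> W;
  rmul : V -> W -> W;
  lmul_linearl : forall w, linear (lmul^~ w);
  lmul_linearr : forall x, linear (lmul x);
  rmul_linearl : forall w, linear (rmul^~ w);
  rmul_linearr : forall x, linear (rmul x);
  lmulM : forall x y w, lmul (x ** y) w = lmul x (lmul y w);
  rmulM : forall x y w, rmul (x ** y) w = rmul y (rmul x w);
  lrmulC : forall x y w, lmul x (rmul y w) = rmul y (lmul x w)
}.

Program Definition regular_bimodule : bimodule V :=
  @Bimodule V nmul (fun y x => x ** y) _ _ _ _ _ _ _.
Next Obligation. by move=> c y z; rewrite nmulDl nmulZl. Qed.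
Next Obligation. by move=> c y z; rewrite nmulDr nmulZr. Qed.
Next Obligation. by move=> c y z; rewrite nmulDr nmulZr. Qed.
Next Obligation. by move=> c y z; rewrite nmulDl nmulZl. Qed.
Next Obligation. by rewrite nmulA. Qed.
Next Obligation. by rewrite nmulA. Qed.
Next Obligation. by rewrite nmulA. Qed.

Variables (m : subalgebra V) (codim1 : codim_one m).

Program Definition hyperplane_bimodule : bimodule (subvs_of m) :=
  @Bimodule (subvs_of m)
    (fun x w => Subvs (codim_one_mull codim1 x (subvsP w)))
    (fun x w => Subvs (codim_one_mulr codim1 x (subvsP w))) _ _ _ _ _ _ _.
Next Obligation. by move=> c y z; apply: val_inj; rewrite /= nmulDl nmulZl. Qed.
Next Obligation. by move=> c y z; apply: val_inj; rewrite /= nmulDr nmulZr. Qed.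
Next Obligation. by move=> c y z; apply: val_inj; rewrite /= nmulDr nmulZr. Qed.
Next Obligation. by move=> c y z; apply: val_inj; rewrite /= nmulDl nmulZl. Qed.
Next Obligation. by apply: val_inj; rewrite /= nmulA. Qed.
Next Obligation. by apply: val_inj; rewrite /= nmulA. Qed.
Next Obligation. by apply: val_inj; rewrite /= nmulA. Qed.

End Bimodule.

Section Shifts.
Variables (F : fieldType) (V : nilAlgType F) (W : vectType F) (B : bimodule V W).
Implicit Types mu : 'Hom(W, F^o).

Fact left_shift_fun mu x : {f : 'Hom(W, F^o) | f =1 mu \o lmul B x}.
Proof.
by apply: linear_lfun => c w z; rewrite /= lmul_linearr linearP.
Qed.

Fact left_shift_lfun mu :
  {f : 'Hom(V, 'Hom(W, F^o)) | f =1 fun x => sval (left_shift_fun mu x)}.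
Proof.
apply: linear_lfun => c x y; apply/lfunP=> w; rewrite add_lfunE scale_lfunE.
by rewrite !(svalP (left_shift_fun _ _)) /= lmul_linearl linearP.
Qed.

Fact right_shift_fun mu x : {f : 'Hom(W, F^o) | f =1 mu \o rmul B x}.
Proof.
by apply: linear_lfun => c w z; rewrite /= rmul_linearr linearP.
Qed.

Fact right_shift_lfun mu :
  {f : 'Hom(V, 'Hom(W, F^o)) | f =1 fun x => sval (right_shift_fun mu x)}.
Proof.
apply: linear_lfun => c x y; apply/lfunP=> w; rewrite add_lfunE scale_lfunE.
by rewrite !(svalP (right_shift_fun _ _)) /= rmul_linearl linearP.
Qed.

(** The directions of the left and right orbits through mu. *)
Definition left_shift mu := sval (left_shift_lfun mu).
Definition right_shift mu := sval (right_shift_lfun mu).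

Lemma left_shiftE mu x w : left_shift mu x w = mu (lmul B x w).
Proof. by rewrite (svalP (left_shift_lfun mu)) (svalP (left_shift_fun _ _)). Qed.

Lemma right_shiftE mu x w : right_shift mu x w = mu (rmul B x w).
Proof. by rewrite (svalP (right_shift_lfun mu)) (svalP (right_shift_fun _ _)). Qed.

End Shifts.

(** * The action on functionals and the size of its orbits *)

Lemma minus_oneM (F : finFieldType) (V : nilAlgType F) (g h : algebra_group V) :
  minus_one (g * h)%g = minus_one g + minus_one h + minus_one g ** minus_one h.
Proof. by case: g h => [x] [y]. Qed.

Section DualAction.
Variables (F : finFieldType) (V : nilAlgType F) (W : vectType F) (B : bimodule V W).
Local Notation U := (algebra_group V).
Local Notation functional := (finvect_type 'Hom(W, F^o)).
Implicit Types (g h : U) (t s : U * U) (mu : functional) (w : W).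

Definition left_translate g w := w + lmul B (minus_one g) w.
Definition right_translate h w := w + rmul B (minus_one h) w.

Fact left_translate_linear g : linear (left_translate g).
Proof.
by move=> c w z; rewrite /left_translate lmul_linearr scalerDr !addrA [_ + z + _]addrAC.
Qed.

Fact right_translate_linear g : linear (right_translate g).
Proof.
by move=> c w z; rewrite /right_translate rmul_linearr scalerDr !addrA [_ + z + _]addrAC.
Qed.

Lemma lmul0 w : lmul B 0 w = 0.
Proof.
by have [f fE] := linear_lfun (lmul_linearl B w); rewrite -fE linear0.
Qed.
Lemma lmulDl x y w : lmul B (x + y) w = lmul B x w + lmul B y w.
Proof.
by have [f fE] := linear_lfun (lmul_linearl B w); rewrite -!fE linearD.
Qed.
Lemma lmulDr x w z : lmul B x (w + z) = lmul B x w + lmul B x z.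
Proof.
by have [f fE] := linear_lfun (lmul_linearr B x); rewrite -!fE linearD.
Qed.
Lemma rmul0 w : rmul B 0 w = 0.
Proof.
by have [f fE] := linear_lfun (rmul_linearl B w); rewrite -fE linear0.
Qed.
Lemma rmulDl x y w : rmul B (x + y) w = rmul B x w + rmul B y w.
Proof.
by have [f fE] := linear_lfun (rmul_linearl B w); rewrite -!fE linearD.
Qed.
Lemma rmulDr x w z : rmul B x (w + z) = rmul B x w + rmul B x z.
Proof.
by have [f fE] := linear_lfun (rmul_linearr B x); rewrite -!fE linearD.
Qed.

Lemma left_translate1 w : left_translate 1%g w = w.
Proof. by rewrite /left_translate lmul0 addr0. Qed.

Lemma right_translate1 w : right_translate 1%g w = w.
Proof. by rewrite /right_translate rmul0 addr0. Qed.

Lemma left_translateM g h w :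
  left_translate (g * h)%g w = left_translate g (left_translate h w).
Proof.
rewrite /left_translate minus_oneM !lmulDl lmulM lmulDr !addrA.
by congr (_ + _); rewrite addrAC.
Qed.

Lemma right_translateM g h w :
  right_translate (g * h)%g w = right_translate h (right_translate g w).
Proof. by rewrite /right_translate minus_oneM !rmulDl rmulM rmulDr !addrA. Qed.

Lemma translateC g h w : left_translate g (right_translate h w) =
  right_translate h (left_translate g w).
Proof.
by rewrite /left_translate /right_translate lmulDr rmulDr lrmulC addrACA.
Qed.

Fact dual_act_fun mu t : {f : 'Hom(W, F^o) | f =1
  (mu : 'Hom(W, F^o)) \o left_translate t.1 \o right_translate t.2^-1%g}.
Proof.
apply: linear_lfun => c w z /=.
by rewrite right_translate_linear left_translate_linear linearP.
Qed.

(** Precomposition reverses products, whence a right action. *)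
Definition dual_act mu t : functional := sval (dual_act_fun mu t).

Lemma dual_actE mu t w : (dual_act mu t : 'Hom(W, F^o)) w =
  (mu : 'Hom(W, F^o)) (left_translate t.1 (right_translate t.2^-1%g w)).
Proof. by rewrite /dual_act (svalP (dual_act_fun mu t)). Qed.

Fact dual_act1 mu : dual_act mu 1%g = mu.
Proof.
apply/lfunP=> w.
by rewrite [LHS]dual_actE /= invg1 right_translate1 left_translate1.
Qed.

Fact dual_actM mu t s : dual_act mu (t * s)%g = dual_act (dual_act mu t) s.
Proof.
apply/lfunP=> w; rewrite [LHS]dual_actE [RHS]dual_actE [in RHS]dual_actE /=.
by rewrite invMg left_translateM right_translateM -translateC.
Qed.

Definition dual_action := TotalAction dual_act1 dual_actM.

End DualAction.

Section IdealSubgroups.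
Variables (F : finFieldType) (V : nilAlgType F).
Local Notation U := (algebra_group V).
Implicit Types (I J : ideal V) (g h : U).

Definition ideal_subgroup I : {set U} := [set g | minus_one g \in (I : {vspace V})].

Fact ideal_subgroup_group_set I : group_set (ideal_subgroup I).
Proof.
apply/group_setP; split=> [|g h]; rewrite !inE ?mem0v // => gI hI.
by rewrite minus_oneM !memvD // ideal_mull.
Qed.
Canonical ideal_subgroup_group I := Group (ideal_subgroup_group_set I).

(** If k is the conjugate of 1 + y by 1 + x, then (1 + x) (k - 1) = y (1 + x)
    lies in the ideal, and left multiplication by a unit can be undone. *)
Lemma ideal_subgroup_norm I g : g \in 'N(ideal_subgroup I)%g.
Proof.
rewrite inE; apply/subsetP=> _ /imsetP[h hI ->]; set k := (h ^ g)%g.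
have kE : minus_one k + minus_one g ** minus_one k =
    minus_one h + minus_one h ** minus_one g.
  apply: (addrI (minus_one g)); rewrite !addrA [_ + minus_one h]addrC.
  by rewrite -!minus_oneM [in RHS]conjgC.
rewrite !inE in hI *; rewrite -(left_translate1 (regular_bimodule V) (minus_one k)).
rewrite -(mulVg g) left_translateM {2}/left_translate /= kE.
by rewrite /left_translate /= memvD ?ideal_mull ?memvD ?ideal_mulr.
Qed.

Definition full_ideal : ideal V := @Ideal F V fullv
  (fun x y _ => memvf (x ** y)) (fun x y _ => memvf (x ** y)).

Fact zero_ideal_mull x y : y \in 0%VS -> x ** y \in (0%VS : {vspace V}).
Proof. by rewrite memv0 => /eqP->; rewrite nmulr0 mem0v. Qed.
Fact zero_ideal_mulr x y : x \in 0%VS -> x ** y \in (0%VS : {vspace V}).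
Proof. by rewrite memv0 => /eqP->; rewrite nmul0r mem0v. Qed.
Definition zero_ideal : ideal V := Ideal zero_ideal_mull zero_ideal_mulr.

Definition ideal_pair_subgroup I J : {set U * U} :=
  setX (ideal_subgroup I) (ideal_subgroup J).
Canonical ideal_pair_subgroup_group I J := [group of ideal_pair_subgroup I J].

Lemma mem_ideal_pair_subgroup I J t : (t \in ideal_pair_subgroup I J) =
  (minus_one t.1 \in (I : {vspace V})) && (minus_one t.2 \in (J : {vspace V})).
Proof. by case: t => g h; rewrite !inE. Qed.

Lemma ideal_pair_subgroup_norm I J t : t \in 'N(ideal_pair_subgroup I J)%g.
Proof.
case: t => g h; rewrite inE; apply/subsetP=> _ /imsetP[[x y] /setXP[xI yJ] ->].
by apply/setXP; split; rewrite memJ_norm ?ideal_subgroup_norm.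
Qed.

End IdealSubgroups.

Section OrbitSizes.
Variables (F : finFieldType) (V : nilAlgType F) (W : vectType F) (B : bimodule V W).
Local Notation functional := (finvect_type 'Hom(W, F^o)).
Local Notation orbit := (orbit (dual_action B)).
Implicit Types (I J : ideal V) (mu : functional).

Lemma dual_act_fixP mu t :
  reflect (left_shift B mu (minus_one t.1) = right_shift B mu (minus_one t.2))
          (dual_act B mu t == mu).
Proof.
apply: (iffP eqP) => [fix_t | eq_shift].
  apply/lfunP=> w; rewrite left_shiftE right_shiftE.
  have := congr1 (fun f : functional =>
    (f : 'Hom(W, F^o)) (right_translate B t.2 w)) fix_t.
  rewrite dual_actE -right_translateM mulgV right_translate1.
  by rewrite /left_translate /right_translate !linearD => /addrI.
apply/lfunP=> w; rewrite [LHS]dual_actE; set z := right_translate B _ w.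
have -> : w = right_translate B t.2 z.
  by rewrite -right_translateM mulVg right_translate1.
rewrite /left_translate /right_translate !linearD; congr (_ + _).
by move/lfunP: eq_shift => /(_ z); rewrite left_shiftE right_shiftE.
Qed.

(** The stabiliser of mu in a product of ideal subgroups is cut out by the
    condition mu (x w) = mu (w y), which is linear in (x, y). Orbit counting is
    thereby reduced to the rank of (x, y) |-> mu (x _) - mu (_ y). *)
Lemma card_dual_orbit I J mu : #|orbit (ideal_pair_subgroup I J) mu| =
  (#|F| ^ \dim (left_shift B mu @: I + right_shift B mu @: J)%VS)%N.
Proof.
pose IJ := (subvs_of I * subvs_of J)%type.
have [phi phiE] : {phi : 'Hom(IJ, 'Hom(W, F^o)) | phi =1 fun xy =>
    left_shift B mu (vsval xy.1) - right_shift B mu (vsval xy.2)}.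
  apply: linear_lfun => c [x y] [x' y'] /=.
  by rewrite !linearP /= scalerDr addrACA.
pose pair_of (xy : finvect_type IJ) : algebra_group V * algebra_group V :=
  (OnePlus (vsval xy.1), OnePlus (vsval xy.2)).
have pair_inj : injective pair_of.
  by case=> x y [x' y'] [/val_inj-> /val_inj->].
have domE : ideal_pair_subgroup I J = pair_of @: [set: finvect_type IJ].
  apply/setP=> -[[x] [y]]; rewrite mem_ideal_pair_subgroup /=.
  apply/andP/imsetP=> [[xI yJ] | [[x' y'] _ [-> ->]]]; last by rewrite !subvsP.
  by exists (Subvs xI, Subvs yJ); rewrite ?inE.
have stabE : ('C_(ideal_pair_subgroup I J)[mu | dual_action B])%g =
    pair_of @: [set xy : finvect_type IJ | xy \in lker phi].
  apply/setP=> t; rewrite inE (sameP astab1P eqP) domE.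
  apply/andP/imsetP=> [[/imsetP[xy _ ->] /dual_act_fixP fix_xy] | [xy]].
    exists xy => //; rewrite inE memv_ker phiE fix_xy subrr eqxx //.
  rewrite inE memv_ker phiE subr_eq0 => /eqP eq_xy ->.
  by split; [apply: imset_f | apply/dual_act_fixP].
have limgE : limg phi = (left_shift B mu @: I + right_shift B mu @: J)%VS.
  apply/vspaceP=> f; apply/memv_imgP/memv_addP.
    case=> -[x y] _ ->; exists (left_shift B mu (vsval x)).
      by rewrite memv_img ?subvsP.
    exists (- right_shift B mu (vsval y)); last by rewrite phiE.
    by rewrite memvN memv_img ?subvsP.
  case=> _ /memv_imgP[x xI ->] [_ /memv_imgP[y yJ ->] ->].
  exists (Subvs xI, - Subvs yJ); first exact: memvf.
  by rewrite phiE /= linearN opprK.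
have fullE : #|ideal_pair_subgroup I J| = (#|F| ^ \dim {:IJ})%N.
  rewrite domE card_imset // cardsT.
  have <- := @card_vspace F (finvect_type IJ) _ fullv.
  by apply: eq_card => xy; rewrite memvf.
have kerE : #|('C_(ideal_pair_subgroup I J)[mu | dual_action B])%g| =
    (#|F| ^ \dim (lker phi))%N.
  rewrite stabE card_imset //.
  have <- := @card_vspace F (finvect_type IJ) _ (lker phi).
  by apply: eq_card => xy; rewrite inE.
have := card_orbit_stab (dual_action B) (ideal_pair_subgroup_group I J) mu.
rewrite -limgE kerE fullE -(limg_ker_dim phi fullv) capfv addnC expnD => /eqP.
by rewrite eqn_pmul2r ?expn_gt0 ?(ltnW (finNzRing_gt1 F)) // => /eqP.
Qed.

(** Elements of the ambient group permute the orbits of a normal subgroup. *)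
Lemma card_orbit_dual_act I J mu t :
  #|orbit (ideal_pair_subgroup I J) (dual_act B mu t)|
    = #|orbit (ideal_pair_subgroup I J) mu|.
Proof.
rewrite -[in LHS](normP (ideal_pair_subgroup_norm I J t)).
by rewrite -[dual_act B mu t]/(dual_action B mu t) -setact_orbit card_setact.
Qed.

End OrbitSizes.

(** * Orbits of functionals on the algebra and on its hyperplane *)

(** The algebra W is embedded by j as an ideal I of V, and acts on itself through
    V. This is used for V inside itself and for its hyperplane. *)
Section OrbitComparison.
Variables (F : finFieldType) (V W : nilAlgType F) (B : bimodule V W).
Variables (I : ideal V) (j : W -> V).
Hypothesis jI : forall x, j x \in (I : {vspace V}).
Hypothesis j_surj : forall v, v \in (I : {vspace V}) -> exists x, j x = v.
Hypothesis lmul_j : forall x w, lmul B (j x) w = x ** w.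
Hypothesis rmul_j : forall x w, rmul B (j x) w = w ** x.
Implicit Types (g h : algebra_group W) (l : dual W).

Let right_translate_j h w :
  right_translate B (OnePlus (j (minus_one h)))^-1%g w = ag_ract w h^-1%g.
Proof.
have ractK z : right_translate B (OnePlus (j (minus_one h))) z = ag_ract z h.
  by rewrite /right_translate /= rmul_j.
have {1}-> : w = ag_ract (ag_ract w h^-1%g) h.
  have := right_translateM (regular_bimodule W) h^-1%g h w.
  by rewrite mulVg right_translate1.
by rewrite -ractK -right_translateM mulgV right_translate1.
Qed.

Lemma left_orbit_dual_action l :
  left_orbit l = orbit (dual_action B) (ideal_pair_subgroup I (zero_ideal V)) l.
Proof.
apply/setP=> mu; apply/imsetP/imsetP=> [[g _ ->] | [[g h]]].
  exists (OnePlus (j (minus_one g^-1%g)), 1%g).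
    by rewrite mem_ideal_pair_subgroup /= jI mem0v.
  apply/lfunP=> w; rewrite [LHS]dual_lactE [RHS]dual_actE /=.
  by rewrite invg1 right_translate1 /left_translate lmul_j.
rewrite mem_ideal_pair_subgroup /= memv0 => /andP[/j_surj[x xg] /eqP h0] ->.
exists (OnePlus x)^-1%g => //; apply/lfunP=> w.
rewrite [LHS]dual_actE [RHS]dual_lactE /= invgK.
have -> : h = 1%g by apply: (can_inj (@minus_oneK F V)).
by rewrite invg1 right_translate1 /left_translate -xg lmul_j.
Qed.

Lemma two_sided_orbit_dual_action l :
  two_sided_orbit l = orbit (dual_action B) (ideal_pair_subgroup I I) l.
Proof.
have actE g h : dual_ract (dual_lact g l) h = dual_act B l
    (OnePlus (j (minus_one g^-1%g)), OnePlus (j (minus_one h))).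
  apply/lfunP=> w; rewrite [LHS]dual_ractE [LHS]dual_lactE [RHS]dual_actE /=.
  by rewrite right_translate_j /left_translate lmul_j.
apply/setP=> mu; apply/imset2P/imsetP=> [[g h _ _ ->] | [[g h]]].
  rewrite actE; eexists; last reflexivity.
  by rewrite mem_ideal_pair_subgroup /= !jI.
rewrite mem_ideal_pair_subgroup /= => /andP[/j_surj[x xg] /j_surj[y yh]] ->.
exists (OnePlus x)^-1%g (OnePlus y) => //.
by rewrite actE invgK /= xg yh !minus_oneK.
Qed.

End OrbitComparison.

Section FullOrbits.
Variables (F : finFieldType) (V : nilAlgType F).
Local Notation B := (regular_bimodule V).
Implicit Types l : dual V.

Lemma left_orbit_regular l : left_orbit l =
  orbit (dual_action B) (ideal_pair_subgroup (full_ideal V) (zero_ideal V)) l.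
Proof.
apply: (@left_orbit_dual_action F V V B (full_ideal V) id) => // [x|v _].
  exact: memvf.
by exists v.
Qed.

Lemma two_sided_orbit_regular l : two_sided_orbit l =
  orbit (dual_action B) (ideal_pair_subgroup (full_ideal V) (full_ideal V)) l.
Proof.
apply: (@two_sided_orbit_dual_action F V V B (full_ideal V) id) => // [x|v _].
  exact: memvf.
by exists v.
Qed.

Lemma card_left_orbit l :
  #|left_orbit l| = (#|F| ^ \dim (limg (left_shift B l)))%N.
Proof. by rewrite left_orbit_regular card_dual_orbit limg0 addv0. Qed.

Lemma card_two_sided_orbit l : #|two_sided_orbit l| =
  (#|F| ^ \dim (limg (left_shift B l) + limg (right_shift B l))%VS)%N.
Proof. by rewrite two_sided_orbit_regular card_dual_orbit. Qed.

(** |U l U| <= |U l| |l U|, and |U l| = |l U| because row rank equals column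
    rank. *)
Lemma card_two_sided_orbit_leq l :
  (#|two_sided_orbit l| <= #|left_orbit l| ^ 2)%N.
Proof.
rewrite card_two_sided_orbit card_left_orbit -expnM.
rewrite leq_pexp2l ?(ltnW (finNzRing_gt1 F)) // muln2 -addnn.
have {2}-> := @rank_transpose _ _ _ (left_shift B l) (right_shift B l) _.
  by rewrite -dimv_sum_cap leq_addr.
by move=> x y; rewrite left_shiftE right_shiftE.
Qed.

End FullOrbits.

Section HyperplaneOrbits.
Variables (F : finFieldType) (V : nilAlgType F) (m : subalgebra V).
Variable codim1 : codim_one m.
Local Notation B := (hyperplane_bimodule codim1).
Local Notation I := (codim_one_ideal codim1).
Implicit Types l : dual (subvs_of m).

Lemma left_orbit_hyperplane l : left_orbit l =
  orbit (dual_action B) (ideal_pair_subgroup I (zero_ideal V)) l.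
Proof.
apply: (@left_orbit_dual_action F V (subvs_of m) B I vsval) => [x|v vm|x w].
- exact: subvsP.
- by exists (Subvs vm).
- exact: val_inj.
Qed.

Lemma two_sided_orbit_hyperplane l : two_sided_orbit l =
  orbit (dual_action B) (ideal_pair_subgroup I I) l.
Proof.
apply: (@two_sided_orbit_dual_action F V (subvs_of m) B I vsval) => [x|v vm|x w|x w].
- exact: subvsP.
- by exists (Subvs vm).
- exact: val_inj.
- exact: val_inj.
Qed.

End HyperplaneOrbits.

(** * Orthogonality of the characters of the additive group *)

Section Fourier.
Variables (F : finFieldType) (theta : F -> algC).
Hypothesis theta_char : nontrivial_additive_character theta.

Lemma theta_neq0 x : theta x != 0. Proof. by case: theta_char. Qed.
Lemma thetaD x y : theta (x + y) = theta x * theta y.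
Proof. by case: theta_char. Qed.

Lemma theta0 : theta 0 = 1.
Proof. by apply: (mulfI (theta_neq0 0)); rewrite -thetaD addr0 mulr1. Qed.

Lemma thetaN x : theta (- x) = (theta x)^-1.
Proof. by apply: (mulfI (theta_neq0 x)); rewrite -thetaD subrr theta0 mulfV ?theta_neq0. Qed.

Lemma thetaMn x k : theta (x *+ k) = theta x ^+ k.
Proof. by elim: k => [|k IHk]; rewrite ?theta0 // mulrS exprS thetaD IHk. Qed.

(** The values of theta are p-th roots of unity for the characteristic p. *)
Lemma conj_theta x : (theta x)^* = theta (- x).
Proof.
have [p p_pr pcharFp] := finPcharP F.
have : theta x ^+ p = 1 by rewrite -thetaMn mulrn_pchar // theta0.
move/(congr1 Num.norm)/eqP; rewrite normrX normr1 pexpr_eq1 ?prime_gt0 ?normr_ge0 //.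
by move=> /eqP norm1; rewrite thetaN invC_norm norm1 expr1n invr1 mul1r.
Qed.

Section Algebra.
Variable V : nilAlgType F.
Local Notation U := (algebra_group V).
Implicit Types (l mu : dual V) (g : U).
Local Notation ev l g := ((l : 'Hom(V, F^o)) (minus_one g)).

Lemma sum_theta_functional (l : 'Hom(V, F^o)) :
  \sum_(g : U) theta (l (minus_one g)) = #|U|%:R *+ (l == 0).
Proof.
have [-> | l_nz] := eqVneq l 0.
  under eq_bigr do rewrite zero_lfunE theta0.
  by rewrite sumr_const cardT -cardE.
rewrite mulr0n.
have [|x _ lx] := @functional_separation F V 0%VS l; first by rewrite memv0.
have [_ _ [c theta_c]] := theta_char; set S := \sum_g _.
pose y := (c / l x : F) *: x.
have ly : l y = c by rewrite linearZ /= /GRing.scale /= divfK.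
(* Translating the summation variable by y multiplies the sum by theta c. *)
have translate : S = theta c * S.
  have shiftK : cancel (fun g : U => OnePlus (minus_one g - y))
                       (fun g : U => OnePlus (minus_one g + y)).
    by case=> z /=; rewrite subrK.
  have shiftK' : cancel (fun g : U => OnePlus (minus_one g + y))
                        (fun g : U => OnePlus (minus_one g - y)).
    by case=> z /=; rewrite addrK.
  rewrite mulr_sumr /S (reindex (fun g : U => OnePlus (minus_one g + y))) /=.
    by apply: eq_bigr => g _; rewrite linearD /= ly thetaD mulrC.
  exact: onW_bij (Bijective shiftK' shiftK).
apply/eqP; have : (theta c - 1) * S = 0.
  by rewrite mulrBl mul1r -translate subrr.
by move/eqP; rewrite mulf_eq0 subr_eq0 (negPf theta_c).
Qed.

Lemma fourier_coefficient (A : {set dual V}) mu :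
  \sum_(g : U) (\sum_(l in A) theta (ev l g)) * theta (- ev mu g)
    = #|U|%:R *+ (mu \in A).
Proof.
under eq_bigr do rewrite mulr_suml.
rewrite exchange_big /=.
have sumE l : \sum_(g : U) theta (ev l g) * theta (- ev mu g) =
    #|U|%:R *+ (l == mu).
  rewrite -subr_eq0 -(sum_theta_functional (l - mu)); apply: eq_bigr => g _.
  by rewrite -thetaD add_lfunE opp_lfunE.
under eq_bigr do rewrite sumE.
have [muA | muNA] := boolP (mu \in A).
  by rewrite (bigD1 mu) //= eqxx big1 ?addr0 // => l /andP[_ /negPf->].
by rewrite big1 // => l lA; case: eqP lA muNA => // -> ->.
Qed.

Lemma card_ag_neq0 : #|U|%:R != 0 :> algC.
Proof. by rewrite pnatr_eq0 -lt0n; apply/card_gt0P; exists 1%g. Qed.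

Lemma card_left_orbit_neq0 l : #|left_orbit l|%:R != 0 :> algC.
Proof. by rewrite card_left_orbit natrX expf_neq0 // pnatr_eq0 -lt0n ltnW // finNzRing_gt1. Qed.

Lemma card_two_sided_orbit_neq0 l : #|two_sided_orbit l|%:R != 0 :> algC.
Proof.
by rewrite card_two_sided_orbit natrX expf_neq0 // pnatr_eq0 -lt0n ltnW // finNzRing_gt1.
Qed.

Lemma two_sided_orbit_refl l : l \in two_sided_orbit l.
Proof. by rewrite two_sided_orbit_regular orbit_refl. Qed.

Lemma two_sided_orbit_eq l mu :
  mu \in two_sided_orbit l -> two_sided_orbit mu = two_sided_orbit l.
Proof. by rewrite !two_sided_orbit_regular => /orbit_eqP. Qed.

(** The Fourier coefficient of a supercharacter at l is nonzero exactly when l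
    lies in its orbit. *)
Lemma supercharacter_orbit_inj l mu :
  supercharacter theta l = supercharacter theta mu ->
  two_sided_orbit l = two_sided_orbit mu.
Proof.
move=> eq_lm; apply: two_sided_orbit_eq; apply: contraT => lNmu.
pose coef k := \sum_(g : U) supercharacter theta k g * theta (- ev l g).
have coefE k : coef k = #|left_orbit k|%:R / #|two_sided_orbit k|%:R *
    (#|U|%:R *+ (l \in two_sided_orbit k)).
  rewrite /coef -fourier_coefficient mulr_sumr.
  by apply: eq_bigr => g _; rewrite ffunE mulrA.
have : coef l == coef mu by rewrite /coef eq_lm.
rewrite !coefE two_sided_orbit_refl (negPf lNmu) mulr0 !mulf_eq0 invr_eq0.
by rewrite (negPf (card_left_orbit_neq0 _)) (negPf (card_two_sided_orbit_neq0 _))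
           (negPf card_ag_neq0).
Qed.

(** The norm of the supercharacter of l is |U l|^2 / |U l U|. *)
Lemma irreducible_card_orbit l : irreducible_character (supercharacter theta l) ->
  (#|left_orbit l| ^ 2)%N = #|two_sided_orbit l|.
Proof.
case=> phi irr_phi phiE; set O := two_sided_orbit l; set L := left_orbit l.
have /eqP : '[phi] == 1 by case/irrP: irr_phi => i ->; rewrite cfnorm_irr.
rewrite cfdotE cardsT.
have -> : \sum_(g in [set: U]) phi g * (phi g)^* =
    (#|L|%:R / #|O|%:R) ^+ 2 * (#|O|%:R * #|U|%:R).
  have -> : #|O|%:R * #|U|%:R = \sum_(mu in O) (#|U|%:R *+ (mu \in O)) :> algC.
    rewrite (eq_bigr (fun=> #|U|%:R)) => [|mu ->] //.
    by rewrite sumr_const mulr_natl.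
  under [X in _ = _ * X]eq_bigr do rewrite -fourier_coefficient.
  rewrite exchange_big mulr_sumr /=; apply: eq_big => [g|g _]; first by rewrite inE.
  rewrite -phiE ffunE -mulr_sumr rmorphM rmorph_sum /=.
  rewrite expr2 mulrACA; congr (_ * _ * (_ * _)).
    by rewrite fmorph_div /= !rmorph_nat.
  by apply: eq_bigr => mu _; rewrite conj_theta.
move=> norm1; have U_nz := card_ag_neq0; have O_nz := card_two_sided_orbit_neq0 l.
apply/eqP; rewrite -(eqr_nat algC) natrX -/O.
rewrite -/O -/U in norm1 O_nz U_nz.
have -> : #|L|%:R ^+ 2 = #|O|%:R * (#|U|%:R^-1 *
    ((#|L|%:R / #|O|%:R) ^+ 2 * (#|O|%:R * #|U|%:R))) :> algC by field; apply/andP.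
by rewrite norm1 mulr1.
Qed.

End Algebra.
End Fourier.

(** * Restricting functionals to the hyperplane *)

Lemma orbit_average (aT : finGroupType) (T : finType) (to : {action aT &-> T})
    (G : {group aT}) (x : T) (f : T -> algC) :
  (\sum_(y in orbit to G x) f y) / #|orbit to G x|%:R =
  (\sum_(a in G) f (to x a)) / #|G|%:R.
Proof.
set O := orbit to G x; set c := #|('C_G[x | to])%g|.
have -> : \sum_(a in G) f (to x a) = c%:R * \sum_(y in O) f y.
  rewrite (partition_big (to x) (mem O)) /= => [|a]; last exact: mem_orbit.
  rewrite mulr_sumr; apply: eq_bigr => _ /imsetP[a Ga ->].
  rewrite (eq_bigr (fun=> f (to x a))) => [|b /andP[_ /eqP->] //].
  rewrite sumr_const [RHS]mulr_natl; congr (_ *+ _).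
  rewrite /c -(card_rcoset _ a) -amove_act ?subsetT //.
  by apply: eq_card => b; rewrite !inE.
have c_nz : c%:R != 0 :> algC by rewrite pnatr_eq0 -lt0n cardG_gt0.
by rewrite -(card_orbit_stab to G x) -/c -/O natrM invfM [c%:R * _]mulrC !mulrA [RHS]mulrAC mulfK.
Qed.

Section Restriction.
Variables (F : finFieldType) (V : nilAlgType F) (m : subalgebra V).
Variable codim1 : codim_one m.
Local Notation B := (hyperplane_bimodule codim1).
Local Notation R := (regular_bimodule V).
Local Notation I := (codim_one_ideal codim1).
Implicit Types l mu : dual V.

Fact restrict_functional_fun (f : 'Hom(V, F^o)) :
  {g : 'Hom(subvs_of m, F^o) | g =1 fun w => f (vsval w)}.
Proof. by apply: linear_lfun => c x y; rewrite !linearP. Qed.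

Fact restrict_functional_lfun :
  {r : 'Hom('Hom(V, F^o), 'Hom(subvs_of m, F^o)) |
    r =1 fun f => sval (restrict_functional_fun f)}.
Proof.
apply: linear_lfun => c f g; apply/lfunP=> w; rewrite add_lfunE scale_lfunE.
by rewrite !(svalP (restrict_functional_fun _)) add_lfunE scale_lfunE.
Qed.

Definition restrict_functional := sval restrict_functional_lfun.
Local Notation res := restrict_functional.

Lemma restrict_functionalE f w : res f w = f (vsval w).
Proof.
by rewrite (svalP restrict_functional_lfun) (svalP (restrict_functional_fun f)).
Qed.

Lemma restrict_dual_act l t :
  res (dual_act R l t) = dual_act B (res l : dual (subvs_of m)) t.
Proof.
by apply/lfunP=> w; rewrite restrict_functionalE dual_actE [RHS]dual_actE restrict_functionalE.
Qed.

Lemma left_shift_restrict l : left_shift B (res l) = (res \o left_shift R l)%VF.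
Proof.
apply/lfunP=> x; apply/lfunP=> w.
by rewrite comp_lfunE restrict_functionalE !left_shiftE restrict_functionalE.
Qed.

Lemma right_shift_restrict l : right_shift B (res l) = (res \o right_shift R l)%VF.
Proof.
apply/lfunP=> x; apply/lfunP=> w.
by rewrite comp_lfunE restrict_functionalE !right_shiftE restrict_functionalE.
Qed.

(** The algebra modulo m is nilpotent of dimension one, hence has zero
    product. *)
Lemma codim_one_nmul x y : x ** y \in m.
Proof.
apply: (codim_one_nilp codim1 (f := nmul x)) => [z|]; first exact: codim_one_mull.
by have [k nilk] := iter_nmull_nilp V; exists k => z; apply: nilk.
Qed.

Variable nu : 'Hom(V, F^o).
Hypotheses (nu_nz : nu != 0) (res_nu : res nu = 0).

Lemma kill_hyperplane x : x \in m -> nu x = 0.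
Proof.
move=> xm; have := congr1 (fun f : 'Hom(subvs_of m, F^o) => f (Subvs xm)) res_nu.
by rewrite restrict_functionalE zero_lfunE.
Qed.

Lemma ker_restrict f : res f = 0 -> f \in <[nu]>%VS.
Proof.
move=> res_f; have [v nu_v] : exists v, nu v != 0.
  have [|v _ nu_v] := @functional_separation F V 0%VS nu; first by rewrite memv0.
  by exists v.
have vNm : v \notin m by apply: contra nu_v => /kill_hyperplane->.
apply/vlineP; exists (f v / nu v); apply/lfunP=> x; rewrite scale_lfunE.
have [c xm] := codim_one_split codim1 x vNm.
have f_m : f (x - c *: v) = 0.
  have := congr1 (fun g : 'Hom(subvs_of m, F^o) => g (Subvs xm)) res_f.
  by rewrite restrict_functionalE zero_lfunE.
have := kill_hyperplane xm; move: f_m.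
rewrite !linearB !linearZ /= !scalerN => /eqP; rewrite subr_eq0 => /eqP-> /eqP.
by rewrite subr_eq0 => /eqP->; rewrite /GRing.scale /= mulrCA divfK // mulrC.
Qed.

(** The kernel of the restriction is the line through nu. *)
Lemma dim_restrict (U : {vspace 'Hom(V, F^o)}) :
  (\dim U <= \dim (res @: U) + (nu \in U))%N.
Proof.
rewrite -(limg_ker_dim res U) addnC leq_add2l.
have sub : (U :&: lker res <= <[nu]>)%VS.
  apply/subvP=> f /memv_capP[_]; rewrite memv_ker => /eqP; exact: ker_restrict.
have [nuU | nuNU] := boolP (nu \in U).
  by rewrite (leq_trans (dimvS sub)) // dim_vline leq_b1.
rewrite leqn0 dimv_eq0 -subv0; apply/subvP=> f fU.
have /vlineP[c fE] := subvP sub f fU; move: fU; rewrite memv_cap fE => /andP[cU _].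
have [-> | c_nz] := eqVneq c 0; first by rewrite scale0r mem0v.
by case/negP: nuNU; rewrite -(scalerK c_nz nu) memvZ.
Qed.

(** Here l and r are the two maps given by one bilinear form on the algebra. If
    an argument y outside m enlarges the span of the functionals r y on m, then
    some w in m is killed by r z for every z in m but not by r y, and l w is a
    nonzero multiple of nu. *)
Lemma hyperplane_functional_in_limg (l r : 'Hom(V, 'Hom(V, F^o))) :
  (forall x y, l x y = r y x) ->
  (\dim ((res \o r)%VF @: m) < \dim (limg (res \o r)%VF))%N -> nu \in limg l.
Proof.
move=> lr; rewrite ltnNge => ltdim.
have /subvPn[_ /memv_imgP[y _ ->]] :
    ~~ (limg (res \o r)%VF <= (res \o r)%VF @: m)%VS.
  by apply: contra ltdim => /dimvS.
case/functional_separation=> w kill_m; rewrite comp_lfunE restrict_functionalE => rw_nz.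
have : l (vsval w) \in <[nu]>%VS.
  apply: ker_restrict; apply/lfunP=> z.
  rewrite restrict_functionalE zero_lfunE lr -restrict_functionalE -comp_lfunE.
  by rewrite kill_m ?memv_img ?subvsP.
case/vlineP=> c lwE; have c_nz : c != 0.
  by apply: contra rw_nz => /eqP c0; rewrite -lr lwE c0 scale0r zero_lfunE.
by rewrite -(scalerK c_nz nu) -lwE memvZ ?memv_img ?memvf.
Qed.

Lemma dual_act_nu t : dual_act R nu t = nu.
Proof.
apply/lfunP=> x; rewrite dual_actE /left_translate /right_translate /=.
by rewrite !linearD /= !(kill_hyperplane (codim_one_nmul _ _)) !addr0.
Qed.

Lemma dual_actD l mu t :
  dual_act R ((l : 'Hom(V, F^o)) + (mu : 'Hom(V, F^o))) t
    = (dual_act R l t : 'Hom(V, F^o)) + (dual_act R mu t : 'Hom(V, F^o)).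
Proof. by apply/lfunP=> x; rewrite add_lfunE !dual_actE add_lfunE. Qed.

Lemma nu_in_left_shift l : nu \in limg (left_shift R l) ->
  ((l : 'Hom(V, F^o)) + nu : dual V) \in two_sided_orbit l.
Proof.
case/memv_imgP=> x _ nuE; rewrite two_sided_orbit_regular.
apply/imsetP; exists (OnePlus x, 1%g); first by rewrite mem_ideal_pair_subgroup !memvf.
apply/lfunP=> w; rewrite [RHS]dual_actE /= invg1 right_translate1 /left_translate.
by rewrite linearD nuE add_lfunE left_shiftE.
Qed.

Lemma nu_in_right_shift l : nu \in limg (right_shift R l) ->
  ((l : 'Hom(V, F^o)) + nu : dual V) \in two_sided_orbit l.
Proof.
case/memv_imgP=> x _ nuE; rewrite two_sided_orbit_regular.
apply/imsetP; exists (1%g, (OnePlus x)^-1%g).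
  by rewrite mem_ideal_pair_subgroup !memvf.
apply/lfunP=> w; rewrite [RHS]dual_actE /= invgK left_translate1 /right_translate.
by rewrite linearD nuE add_lfunE right_shiftE.
Qed.

Lemma two_sided_orbit_stable l : ((l : 'Hom(V, F^o)) + nu : dual V) \in two_sided_orbit l ->
  [set ((mu : 'Hom(V, F^o)) + nu : dual V) | mu : dual V in two_sided_orbit l] = two_sided_orbit l.
Proof.
move=> stab; apply/eqP; rewrite eqEcard card_imset => [|mu mu']; last first.
  exact: (@addIr 'Hom(V, F^o)).
rewrite leqnn andbT; apply/subsetP=> _ /imsetP[mu mu_l ->].
rewrite -(two_sided_orbit_eq stab); move: mu_l; rewrite !two_sided_orbit_regular.
case/imsetP=> t tT ->; apply/imsetP; exists t => //=.
by rewrite dual_actD dual_act_nu.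
Qed.

Let exponent_arithmetic (dL dL' dLm dR' dRm dS' dSm : nat) :
  (dL <= dL'.+1)%N -> (dL' <= dLm.+1)%N -> (dR' <= dRm.+1)%N ->
  (dLm <= dL')%N -> (dRm <= dR')%N -> (dSm <= dS')%N -> (dL' <= dL)%N ->
  (dS' + dLm + dRm <= dSm + dL' + dR')%N -> ((dRm < dR')%N -> (dL' < dL)%N) ->
  let b := (dS' - dSm)%N in let a := (dL - dLm - b)%N in
  [/\ (a + b <= 2)%N, dL = (a + b + dLm)%N & dS' = (b + dSm)%N].
Proof. by move=> *; split; lia. Qed.

(** Here a + b is the rank lost by the form (x, y) |-> l (x y) when it
    is restricted to m, and b is the part of it seen by the two-sided orbit of
    the restricted functional. Losing any rank puts nu into the left or the
    right orbit directions of l. *)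
Lemma restriction_exponents l (l' := res l : dual (subvs_of m)) :
  exists a b,
  [/\ (a + b <= 2)%N,
      \dim (limg (left_shift R l)) = (a + b + \dim (left_shift B l' @: m))%N,
      \dim (limg (left_shift B l') + limg (right_shift B l'))%VS
        = (b + \dim (left_shift B l' @: m + right_shift B l' @: m)%VS)%N,
      (\dim (limg (left_shift R l) + limg (right_shift R l))%VS
        <= (\dim (limg (left_shift B l') + limg (right_shift B l'))%VS).+1)%N
    & (0 < a + b)%N ->
      ((l : 'Hom(V, F^o)) + nu : dual V) \in two_sided_orbit l].
Proof.
have leftE := left_shift_restrict l; have rightE := right_shift_restrict l.
rewrite -/l' in leftE rightE.
have shiftC x y : left_shift R l x y = right_shift R l y x.
  by rewrite left_shiftE right_shiftE.
have resL : limg (left_shift B l') = (res @: limg (left_shift R l))%VS.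
  by rewrite leftE limg_comp.
have resR : limg (right_shift B l') = (res @: limg (right_shift R l))%VS.
  by rewrite rightE limg_comp.
have nu_leftP : (\dim (right_shift B l' @: m) < \dim (limg (right_shift B l')))%N ->
    nu \in limg (left_shift R l).
  by rewrite rightE; apply: hyperplane_functional_in_limg.
have nu_rightP : (\dim (left_shift B l' @: m) < \dim (limg (left_shift B l')))%N ->
    nu \in limg (right_shift R l).
  by rewrite leftE; apply: hyperplane_functional_in_limg => x y; rewrite shiftC.
have dimL := dim_restrict (limg (left_shift R l)); rewrite -resL in dimL.
have dimLR := dim_restrict (limg (left_shift R l) + limg (right_shift R l))%VS.
rewrite limgD -resL -resR in dimLR.
have hypL := dim_limg_hyperplane (left_shift B l') codim1.
have hypR := dim_limg_hyperplane (right_shift B l') codim1.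
have subL : (\dim (left_shift B l' @: m) <= \dim (limg (left_shift B l')))%N.
  by rewrite dimvS ?limgS ?subvf.
have subR : (\dim (right_shift B l' @: m) <= \dim (limg (right_shift B l')))%N.
  by rewrite dimvS ?limgS ?subvf.
have incr := dim_sum_increment (limgS (left_shift B l') (subvf m))
                               (limgS (right_shift B l') (subvf m)).
have subLR : (\dim (left_shift B l' @: m + right_shift B l' @: m)
    <= \dim (limg (left_shift B l') + limg (right_shift B l')))%N.
  by rewrite dimvS ?addvS ?limgS ?subvf.
have dimL' : (\dim (limg (left_shift B l')) + (nu \in limg (left_shift R l))
    <= \dim (limg (left_shift R l)))%N.
  rewrite -(limg_ker_dim res (limg (left_shift R l))) -resL addnC leq_add2r.
  case nuL: (nu \in _) => //=; rewrite lt0n dimv_eq0.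
  apply: contraNneq nu_nz => cap0; rewrite -memv0 -cap0 memv_cap nuL memv_ker.
  by rewrite res_nu eqxx.
have growL : (\dim (right_shift B l' @: m) < \dim (limg (right_shift B l')))%N ->
    (\dim (limg (left_shift B l')) < \dim (limg (left_shift R l)))%N.
  by move=> /nu_leftP nuL; rewrite nuL addn1 in dimL'.
have dimLR1 : (\dim (limg (left_shift R l) + limg (right_shift R l)) <=
    (\dim (limg (left_shift B l') + limg (right_shift B l'))).+1)%N.
  by apply: leq_trans dimLR _; rewrite -addn1 leq_add2l leq_b1.
have dimL1 : (\dim (limg (left_shift R l)) <= (\dim (limg (left_shift B l'))).+1)%N.
  by apply: leq_trans dimL _; rewrite -addn1 leq_add2l leq_b1.
have leL : (\dim (limg (left_shift B l')) <= \dim (limg (left_shift R l)))%N.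
  exact: leq_trans (leq_addr _ _) dimL'.
have [ab2 LE SE] :=
  exponent_arithmetic dimL1 hypL hypR subL subR subLR leL incr growL.
eexists; eexists; split; [exact: ab2 | exact: LE | exact: SE | exact: dimLR1 |].
move=> ab_gt0; have : (\dim (left_shift B l' @: m) < \dim (limg (left_shift R l)))%N.
  by rewrite LE -addn1 addnC leq_add2r.
have [nuL _ | nuNL ltL] := boolP (nu \in limg (left_shift R l)).
  exact: nu_in_left_shift.
apply/nu_in_right_shift/nu_rightP; rewrite (negPf nuNL) addn0 in dimL.
exact: leq_trans ltL dimL.
Qed.

End Restriction.

(** * Restricting supercharacters *)

Section SupercharacterRestriction.
Variables (F : finFieldType) (theta : F -> algC).
Hypothesis theta_char : nontrivial_additive_character theta.
Variables (V : nilAlgType F) (m : subalgebra V) (codim1 : codim_one m).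
Local Notation B := (hyperplane_bimodule codim1).
Local Notation R := (regular_bimodule V).
Local Notation I := (codim_one_ideal codim1).
Local Notation full := (full_ideal V).
Local Notation res l := (restrict_functional m (l : 'Hom(V, F^o)) : dual (subvs_of m)).
Local Notation ev l g := ((l : 'Hom(_, F^o)) (minus_one g)).
Implicit Types l : dual V.

(** This is the image under restriction of the two-sided orbit of l, and a union
    of two-sided orbits of the subgroup. *)
Definition restricted_orbit l : {set dual (subvs_of m)} :=
  orbit (dual_action B) (ideal_pair_subgroup full full) (res l).

Lemma sum_restricted_orbit l (f : dual (subvs_of m) -> algC) :
  (\sum_(mu in two_sided_orbit l) f (res mu)) / #|two_sided_orbit l|%:R =
  (\sum_(mu in restricted_orbit l) f mu) / #|restricted_orbit l|%:R.
Proof.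
rewrite two_sided_orbit_regular !orbit_average.
by congr (_ / _); apply: eq_bigr => t _; congr f; apply: restrict_dual_act.
Qed.

Lemma restriction_supercharacterE l g :
  restriction m (supercharacter theta l) g =
    #|left_orbit l|%:R / #|restricted_orbit l|%:R *
    \sum_(mu in restricted_orbit l) theta (ev mu g).
Proof.
rewrite !ffunE /= -mulrA -[RHS]mulrA ![_^-1 * _]mulrC.
rewrite -(sum_restricted_orbit l (fun mu => theta (ev mu g))).
by congr (_ * (_ / _)); apply: eq_bigr => mu _; rewrite restrict_functionalE.
Qed.

Lemma card_two_sided_restricted l mu : mu \in restricted_orbit l ->
  #|two_sided_orbit mu| = #|two_sided_orbit (res l)|.
Proof.
case/imsetP=> t _ ->.
by rewrite !(two_sided_orbit_hyperplane codim1) card_orbit_dual_act.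
Qed.

Lemma card_left_restricted l mu : mu \in restricted_orbit l ->
  #|left_orbit mu| = #|left_orbit (res l)|.
Proof.
case/imsetP=> t _ ->.
by rewrite !(left_orbit_hyperplane codim1) card_orbit_dual_act.
Qed.

Lemma card_restricted_orbit l : #|restricted_orbit l| =
  (#|F| ^ \dim (limg (left_shift B (res l)) + limg (right_shift B (res l)))%VS)%N.
Proof. exact: card_dual_orbit. Qed.

Lemma restricted_orbit_partition l :
  partition [set two_sided_orbit mu | mu in restricted_orbit l] (restricted_orbit l).
Proof.
rewrite (eq_imset _ (two_sided_orbit_hyperplane codim1)).
apply: orbit_partition; apply: subset_trans (acts_orbit _ _ (subsetT _)).
by apply/subsetP=> t; rewrite !mem_ideal_pair_subgroup !memvf.
Qed.

(** The two-sided orbits of the subgroup inside the restricted orbit all have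
    the same size and the same number of left orbits, since the whole group
    permutes them. Each contributes its supercharacter with the same
    coefficient. *)
Lemma restriction_supercharacter_multiple a b l :
  #|left_orbit l| = (#|F| ^ (a + b) * #|left_orbit (res l)|)%N ->
  #|restricted_orbit l| = (#|F| ^ b * #|two_sided_orbit (res l)|)%N ->
  supercharacter_multiple theta a b (restriction m (supercharacter theta l)).
Proof.
set P := restricted_orbit l; set Q0 := two_sided_orbit (res l).
set L0 := left_orbit (res l) => cardL cardP.
pose orbits := [set two_sided_orbit mu | mu in P].
pose rep (Q : {set dual (subvs_of m)}) := odflt (res l) [pick mu in Q].
have partP : partition orbits P := restricted_orbit_partition l.
have repP Q : Q \in orbits -> rep Q \in P /\ two_sided_orbit (rep Q) = Q.
  case/imsetP=> mu muP ->; rewrite /rep; case: pickP => [mu' /= mu'mu | ].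
    rewrite (two_sided_orbit_eq mu'mu); split=> //.
    have /and3P[/eqP <- _ _] := partP; apply/bigcupP.
    by exists (two_sided_orbit mu) => //; apply: imset_f.
  by move/(_ mu); rewrite two_sided_orbit_refl.
exists [seq supercharacter theta (rep Q) | Q <- enum orbits].
have q_gt0 : (0 < #|F|)%N by rewrite ltnW ?finNzRing_gt1.
have superE Q g : Q \in orbits -> supercharacter theta (rep Q) g =
    #|L0|%:R / #|Q0|%:R * \sum_(mu in Q) theta (ev mu g).
  case/repP=> repQ orbQ; rewrite ffunE orbQ (card_left_restricted repQ).
  by rewrite -[in #|Q|]orbQ (card_two_sided_restricted repQ).
split.
- rewrite map_inj_in_uniq ?enum_uniq // => Q Q'; rewrite !mem_enum.
  move=> /repP[_ QE] /repP[_ Q'E] /(supercharacter_orbit_inj theta_char).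
  by rewrite QE Q'E.
- rewrite size_map -cardE; apply/eqP.
  have Q0_gt0 : (0 < #|Q0|)%N by apply/card_gt0P; exists (res l); apply: two_sided_orbit_refl.
  rewrite -(eqn_pmul2r Q0_gt0) -cardP; apply/eqP/esym/card_uniform_partition => //.
  by move=> _ /imsetP[mu muP ->]; apply: card_two_sided_restricted.
- by move=> _ /mapP[Q _ ->]; exists (rep Q).
- have degree Q : Q \in orbits -> supercharacter theta (rep Q) 1%g = #|L0|%:R.
    move=> orbQ; rewrite superE //.
    rewrite (eq_bigr (fun=> 1)) => [|mu _]; last by rewrite linear0 (theta0 theta_char).
    have [/card_two_sided_restricted cardQ QE] := repP Q orbQ.
    rewrite QE in cardQ; rewrite sumr_const cardQ divfK //.
    exact: card_two_sided_orbit_neq0.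
  move=> _ _ /mapP[Q + ->] /mapP[Q' + ->]; rewrite !mem_enum => orbQ orbQ'.
  by rewrite !degree.
move=> g; rewrite restriction_supercharacterE -/P big_map big_enum /=.
rewrite (eq_bigr _ (fun Q orbQ => superE Q g orbQ)) -mulr_sumr.
rewrite (set_partition_big _ partP) mulrA; congr (_ * _).
rewrite cardL cardP expnD !natrM.
have Q0_nz : #|Q0|%:R != 0 :> algC := card_two_sided_orbit_neq0 (res l).
have qb_nz : (#|F| ^ b)%:R != 0 :> algC by rewrite pnatr_eq0 -lt0n expn_gt0 q_gt0.
by field; rewrite Q0_nz qb_nz.
Qed.

End SupercharacterRestriction.

(** * Linear supercharacters and the main theorem *)

Lemma supercharacter_zero_product (F : finFieldType) (theta : F -> algC)
    (V : nilAlgType F) (l : dual V) :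
  (forall x y : V, x ** y = 0) ->
  forall g, supercharacter theta l g = theta ((l : 'Hom(V, F^o)) (minus_one g)).
Proof.
move=> mul0 g.
have lactE h : dual_lact h l = l.
  by apply/lfunP=> x; rewrite [LHS]dual_lactE /ag_lact mul0 addr0.
have ractE h : dual_ract l h = l.
  by apply/lfunP=> x; rewrite [LHS]dual_ractE /ag_ract mul0 addr0.
have leftE : left_orbit l = [set l].
  apply/setP=> mu; rewrite inE; apply/imsetP/eqP=> [[h _ ->] // | ->].
  by exists 1%g.
have twoE : two_sided_orbit l = [set l].
  apply/setP=> mu; rewrite inE; apply/imset2P/eqP=> [[h k _ _ ->] | ->].
    by rewrite lactE ractE.
  by exists 1%g 1%g => //; rewrite lactE ractE.
by rewrite ffunE leftE twoE cards1 big_set1 divr1 mul1r.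
Qed.

(** The quotient by m has zero product, so that its supercharacters are the
    functions theta \o k for functionals k, and nu is k composed with the
    projection. *)
Lemma lifted_supercharacter (F : finFieldType) (theta : F -> algC)
  (theta_char : nontrivial_additive_character theta)
  (n : nilAlgType F) (m : subalgebra n) (codim1 : codim_one m)
  (gamma : {ffun algebra_group (coset_space (codim_one_ideal codim1)) -> algC}) :
  is_supercharacter theta gamma -> (exists g, gamma g <> 1) ->
  exists nu : 'Hom(n, F^o), [/\ nu != 0, restrict_functional m nu = 0
    & forall g, lifted_function gamma g = theta (nu (minus_one g))].
Proof.
set I := codim_one_ideal codim1 in gamma *.
move=> [k gammaE] [g gamma_g].
have mul0 (u w : coset_space I) : u ** w = 0.
  rewrite -[u]coset_of_vec_surj -[w]coset_of_vec_surj.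
  rewrite -[LHS]coset_of_vecM; apply/coset_of_vec_eq0P.
  exact: codim_one_nmul codim1 _ _.
have [nu nuE] : {nu : 'Hom(n, F^o) | nu =1
    fun x => (k : 'Hom(coset_space I, F^o)) (coset_of_vec I x)}.
  by apply: linear_lfun => c x y; rewrite !linearP.
have gammaE' h : gamma h = theta ((k : 'Hom(coset_space I, F^o)) (minus_one h)).
  by rewrite gammaE supercharacter_zero_product.
exists nu; split=> [|| h]; last by rewrite ffunE gammaE' nuE.
  apply/eqP=> nu0; case: gamma_g; rewrite gammaE' -[minus_one g]coset_of_vec_surj.
  by rewrite -nuE nu0 zero_lfunE (theta0 theta_char).
apply/lfunP=> w; rewrite restrict_functionalE zero_lfunE nuE.
by have /coset_of_vec_eq0P -> := subvsP w; rewrite linear0.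
Qed.

(** Multiplication by theta \o nu translates the orbit by nu. *)
Lemma supercharacter_product_stable (F : finFieldType) (theta : F -> algC)
  (theta_char : nontrivial_additive_character theta)
  (n : nilAlgType F) (m : subalgebra n) (codim1 : codim_one m)
  (nu : 'Hom(n, F^o)) (psi : {ffun algebra_group n -> algC}) (l : dual n) :
  restrict_functional m nu = 0 ->
  (forall g, psi g = theta (nu (minus_one g))) ->
  ((l : 'Hom(n, F^o)) + nu : dual n) \in two_sided_orbit l ->
  pointwise_product (supercharacter theta l) psi = supercharacter theta l.
Proof.
move=> res_nu psiE stab; apply/ffunP=> g; rewrite !ffunE psiE -[LHS]mulrA; congr (_ * _).
rewrite mulr_suml -[in RHS](two_sided_orbit_stable codim1 res_nu stab).
rewrite big_imset => [|mu mu' _ _]; last exact: (@addIr 'Hom(n, F^o)).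
by apply: eq_bigr => mu _; rewrite add_lfunE (thetaD theta_char).
Qed.

Unset Implicit Arguments.

Theorem proposition5p1 (F : finFieldType) (theta : F -> algC)
  (theta_char : nontrivial_additive_character theta)
  (n : nilAlgType F) (m : subalgebra n) (codim1 : codim_one m)
  (gamma : {ffun algebra_group (coset_space (codim_one_ideal codim1)) -> algC})
  (gamma_super : is_supercharacter theta gamma)
  (gamma_nontrivial : exists g, gamma g <> 1)
  (chi : {ffun algebra_group n -> algC})
  (chi_super : is_supercharacter theta chi) :
  exists a b : nat,
    [/\ (a + b <= 2)%N /\
        supercharacter_multiple theta a b (restriction m chi),
        irreducible_character chi -> a = 0%N /\ (b = 0%N \/ b = 1%N)
      & pointwise_product chi (lifted_function gamma) <> chi ->
        is_supercharacter theta (restriction m chi) /\ a = 0%N /\ b = 0%N].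
Proof.
have [nu [nu_nz res_nu liftE]] :=
  lifted_supercharacter theta_char gamma_super gamma_nontrivial.
have [l ->] := chi_super.
have [a [b [ab2 dimL dimP dimLR stab]]] :=
  restriction_exponents codim1 nu_nz res_nu l.
set l' : dual (subvs_of m) := restrict_functional m l in dimL dimP dimLR.
have cardL' : #|left_orbit l'| =
    (#|F| ^ \dim (left_shift (hyperplane_bimodule codim1) l' @: m))%N.
  by rewrite (left_orbit_hyperplane codim1) card_dual_orbit limg0 addv0.
have cardL : #|left_orbit l| = (#|F| ^ (a + b) * #|left_orbit l'|)%N.
  by rewrite card_left_orbit dimL cardL' expnD.
have cardP : #|restricted_orbit codim1 l| = (#|F| ^ b * #|two_sided_orbit l'|)%N.
  by rewrite card_restricted_orbit dimP expnD (two_sided_orbit_hyperplane codim1) card_dual_orbit.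
have multiple := restriction_supercharacter_multiple theta_char cardL cardP.
exists a, b; split=> // [irr_chi | moved].
  have cardO : (#|two_sided_orbit l| <= #|F| * #|restricted_orbit codim1 l|)%N.
    rewrite card_two_sided_orbit card_restricted_orbit -expnS.
    by rewrite leq_pexp2l ?(ltnW (finNzRing_gt1 F)).
  (* q^(2a+2b) |U_m l'|^2 = |U l|^2 = |U l U| <= q |P| <= q^(b+1) |U_m l'|^2 *)
  suff : (2 * a + b <= 1)%N by lia.
  have L'_gt0 : (0 < #|left_orbit l'| ^ 2)%N.
    by rewrite expn_gt0 cardL' expn_gt0 (ltnW (finNzRing_gt1 F)).
  have : ((#|F| ^ (a + b)) ^ 2 * #|left_orbit l'| ^ 2
      <= #|F| ^ b.+1 * #|left_orbit l'| ^ 2)%N.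
    rewrite -expnMn -cardL (irreducible_card_orbit theta_char irr_chi).
    apply: leq_trans cardO _; rewrite cardP mulnA -expnS leq_mul2l.
    by rewrite card_two_sided_orbit_leq orbT.
  rewrite leq_pmul2r // -expnM leq_exp2l ?finNzRing_gt1 //; lia.
have : ~~ (0 < a + b)%N.
  apply/negP=> /stab l_nu; case: moved.
  exact: (supercharacter_product_stable theta_char codim1 res_nu liftE l_nu).
rewrite -eqn0Ngt addn_eq0 => /andP[/eqP a0 /eqP b0]; split=> //.
move: multiple; rewrite a0 b0 => -[S [_ sizeS superS _ sumS]].
case: S sizeS superS sumS => [|phi [|//]] //= _ superS sumS.
have [k phiE] := superS phi (mem_head _ _); exists k; rewrite -phiE.
by apply/ffunP=> g; rewrite sumS big_seq1 mul1r.
Qed.
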